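(* Let $\omega(x,y,z) = (x\circ y)z$ with $u\circ v=\tfrac12(uv+vu)$ (the Jordan family, $q=0$). Then: (i) a basis of $U(A^\omega)$ consists of $1, a, b, a^2, ab, ba, b^2, aba, ab^2$; (ii) the structure constants are $a\cdot a = a^2$, $a\cdot b = ab$, $a\cdot ba = aba$, $a\cdot b^2 = ab^2$, $b\cdot a = ba$, $b\cdot b = b^2$, $b\cdot a^2 = a-aba$, $b\cdot ab = b-ab^2$, $b\cdot aba = ba$, $b\cdot ab^2 = b^2$, $ab\cdot a = aba$, $ab\cdot b = ab^2$, $ab\cdot a^2 = a^2$, $ab\cdot ab = ab$, $ab\cdot aba = aba$, $ab\cdot ab^2 = ab^2$, $ba\cdot a = a-aba$, $ba\cdot b = b-ab^2$, $ba\cdot ba = ba$, $ba\cdot b^2 = b^2$, $aba\cdot a = a^2$, $aba\cdot b = ab$, $aba\cdot ba = aba$, $aba\cdot b^2 = ab^2$, where all products of two basis elements different from $1$ that are not listed are $0$; (iii) the Wedderburn decomposition is $U(A^\omega) = \mathfrak{R}\oplus \mathbb{F}\oplus M_2(\mathbb{F})$, where $\mathfrak{R}$ is the radical, of dimension $4$; that is, as a vector space $U(A^\omega)$ is the direct sum of $\mathfrak{R}$ and a subalgebra isomorphic to $U(A^\omega)/\mathfrak{R}\cong \mathbb{F}\oplus M_2(\mathbb{F})$; (iv) up to isomorphism, $U(A^\omega)$ has exactly two finite dimensional irreducible representations.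
   Context: $\mathbb{F}$ is a field of characteristic $0$. $A$ is the 2-dimensional space of $2\times 2$ matrices over $\mathbb{F}$ with zero diagonal, with basis $e_1 = \begin{bmatrix} 0&1\\0&0\end{bmatrix}$, $e_2 = \begin{bmatrix} 0&0\\1&0\end{bmatrix}$; it is closed under triple products $xyz$ of matrices. For a trilinear operation $\omega(x,y,z)$ (a fixed rational linear combination of the six products of $x,y,z$ in all orders), $A^\omega$ denotes the space $A$ with the trilinear operation $\omega$ computed using matrix multiplication. Let $\mathbb{F}\langle a,b\rangle$ be the free unital associative algebra and $\phi\colon A \to \mathbb{F}\langle a,b\rangle$ the linear map with $\phi(e_1)=a$, $\phi(e_2)=b$. The universal associative envelope is $U(A^\omega) = \mathbb{F}\langle a,b\rangle / I$, where $I$ is the two-sided ideal generated by the elements $\omega(\phi(x),\phi(y),\phi(z)) - \phi(\omega(x,y,z))$ for $x,y,z\in\{e_1,e_2\}$. The cosets of $a,b$ in $U(A^\omega)$ are again written $a,b$. Representations of $U(A^\omega)$ are unital algebra homomorphisms to endomorphism algebras. *)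

(* Defs.v *)
From HB Require Import structures.
From mathcomp Require Import all_boot all_order all_algebra.
From mathcomp Require Import generic_quotient ring_quotient boolp.
From mathcomp Require Import monalg.

Set Implicit Arguments.
Unset Strict Implicit.
Unset Printing Implicit Defensive.

Import GRing.Theory.
Local Open Scope ring_scope.
Local Open Scope quotient_scope.

(* Proper two-sided ideals. [idealr] (despite its name) already provides
   stability under left multiplication and 1 \notin I. *)
HB.mixin Record isRightAbsorbing (R : nzRingType) (S : R -> bool) := {
  absorb_r : forall a, {in S, forall u, u * a \in S}
}.

#[short(type="tsideal")]
HB.structure Definition TsIdeal (R : nzRingType) :=
  {S of Idealr R S & isRightAbsorbing R S}.

(* [ring_quotient] only equips quotients of commutative rings with a
   multiplication; here is the quotient of an associative algebra by a proper
   two-sided ideal. *)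
Definition alg_quot (F : comNzRingType) (A : algType F) (I : tsideal A) : Type :=
  Quotient.quot I.

(* Projection and operations are locked to keep unification from unfolding
   them. *)
HB.lock Definition alg_pi (F : comNzRingType) (A : algType F) (I : tsideal A)
  (x : A) : alg_quot I := \pi_(Quotient.quot I) x.

HB.lock Definition alg_repr (F : comNzRingType) (A : algType F) (I : tsideal A)
  (q : alg_quot I) : A := repr (q : Quotient.quot I).

HB.lock Definition alg_quot_mul (F : comNzRingType) (A : algType F)
  (I : tsideal A) (p q : alg_quot I) : alg_quot I :=
  alg_pi I (alg_repr p * alg_repr q).

HB.lock Definition alg_quot_scale (F : comNzRingType) (A : algType F)
  (I : tsideal A) (c : F) (q : alg_quot I) : alg_quot I :=
  alg_pi I (c *: alg_repr q).

Section AlgQuotient.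
Variables (F : comNzRingType) (A : algType F) (I : tsideal A).

Local Notation alg_quot := (alg_quot I).
Local Notation alg_pi := (@alg_pi F A I).
Local Notation alg_repr := (@alg_repr F A I).
Local Notation alg_quot_mul := (@alg_quot_mul F A I).
Local Notation alg_quot_scale := (@alg_quot_scale F A I).

HB.instance Definition _ := Choice.on alg_quot.
HB.instance Definition _ := GRing.Zmodule.on alg_quot.

Lemma alg_reprK : cancel alg_repr alg_pi.
Proof. by move=> q; rewrite alg_pi.unlock alg_repr.unlock reprK. Qed.

Lemma alg_piP (x y : A) : reflect (alg_pi x = alg_pi y) (x - y \in (I : {pred A})).
Proof. by rewrite alg_pi.unlock Quotient.idealrBE; apply: eqP. Qed.

Lemma alg_piB : zmod_morphism alg_pi.
Proof. by move=> x y; rewrite alg_pi.unlock /= !piE. Qed.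

HB.instance Definition _ :=
  GRing.isZmodMorphism.Build A alg_quot alg_pi alg_piB.

Definition alg_quot_one : alg_quot := alg_pi 1.

Let reprB (x : A) : alg_repr (alg_pi x) - x \in (I : {pred A}).
Proof. by apply/alg_piP; rewrite alg_reprK. Qed.

Lemma alg_pi_mul x y : alg_quot_mul (alg_pi x) (alg_pi y) = alg_pi (x * y).
Proof.
rewrite alg_quot_mul.unlock; apply/alg_piP; set x' := alg_repr _; set y' := alg_repr _.
have -> : x' * y' - x * y = x' * (y' - y) + (x' - x) * y.
  by rewrite mulrBr mulrBl addrA subrK.
by apply: rpredD; [apply: idealMr | apply: absorb_r]; apply: reprB.
Qed.

Lemma alg_pi_scale c x : alg_quot_scale c (alg_pi x) = alg_pi (c *: x).
Proof.
by rewrite alg_quot_scale.unlock; apply/alg_piP; rewrite -scalerBr -mulr_algl idealMr ?reprB.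
Qed.

Fact alg_quot_mulA : associative alg_quot_mul.
Proof.
move=> p q r; rewrite -[p]alg_reprK -[q]alg_reprK -[r]alg_reprK.
by rewrite !alg_pi_mul mulrA.
Qed.

Fact alg_quot_mul1q : left_id alg_quot_one alg_quot_mul.
Proof. by move=> p; rewrite -[p]alg_reprK alg_pi_mul mul1r. Qed.

Fact alg_quot_mulq1 : right_id alg_quot_one alg_quot_mul.
Proof. by move=> p; rewrite -[p]alg_reprK alg_pi_mul mulr1. Qed.

Fact alg_quot_mulDl : left_distributive alg_quot_mul +%R.
Proof.
move=> p q r; rewrite -[p]alg_reprK -[q]alg_reprK -[r]alg_reprK.
by rewrite -raddfD !alg_pi_mul mulrDl raddfD.
Qed.

Fact alg_quot_mulDr : right_distributive alg_quot_mul +%R.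
Proof.
move=> p q r; rewrite -[p]alg_reprK -[q]alg_reprK -[r]alg_reprK.
by rewrite -raddfD !alg_pi_mul mulrDr raddfD.
Qed.

Fact alg_quot_nonzero1 : alg_quot_one != 0.
Proof.
rewrite -[0](raddf0 alg_pi); apply/eqP => /alg_piP.
by rewrite subr0 idealr1.
Qed.

HB.instance Definition _ := GRing.Zmodule_isNzRing.Build alg_quot
  alg_quot_mulA alg_quot_mul1q alg_quot_mulq1 alg_quot_mulDl alg_quot_mulDr
  alg_quot_nonzero1.

Fact alg_quot_scaleA c d p :
  alg_quot_scale c (alg_quot_scale d p) = alg_quot_scale (c * d) p.
Proof. by rewrite -[p]alg_reprK !alg_pi_scale scalerA. Qed.

Fact alg_quot_scale1 : left_id 1 alg_quot_scale.
Proof. by move=> p; rewrite -[p]alg_reprK alg_pi_scale scale1r. Qed.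

Fact alg_quot_scaleDr : right_distributive alg_quot_scale +%R.
Proof.
move=> c p q; rewrite -[p]alg_reprK -[q]alg_reprK.
by rewrite -raddfD !alg_pi_scale scalerDr raddfD.
Qed.

Fact alg_quot_scaleDl p : {morph alg_quot_scale^~ p : c d / c + d}.
Proof.
by move=> c d; rewrite -[p]alg_reprK !alg_pi_scale scalerDl raddfD.
Qed.

HB.instance Definition _ := GRing.Zmodule_isLmodule.Build F alg_quot
  alg_quot_scaleA alg_quot_scale1 alg_quot_scaleDr alg_quot_scaleDl.

Fact alg_quot_scaleAl c (p q : alg_quot) : c *: (p * q) = (c *: p) * q.
Proof.
rewrite -[p]alg_reprK -[q]alg_reprK /GRing.mul /GRing.scale /=.
by rewrite !(alg_pi_mul, alg_pi_scale) scalerAl.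
Qed.

HB.instance Definition _ :=
  GRing.Lmodule_isLalgebra.Build F alg_quot alg_quot_scaleAl.

Fact alg_quot_scaleAr c (p q : alg_quot) : c *: (p * q) = p * (c *: q).
Proof.
rewrite -[p]alg_reprK -[q]alg_reprK /GRing.mul /GRing.scale /=.
by rewrite !(alg_pi_mul, alg_pi_scale) scalerAr.
Qed.

HB.instance Definition _ :=
  GRing.Lalgebra_isAlgebra.Build F alg_quot alg_quot_scaleAr.

Fact alg_pi_monoid_morphism : monoid_morphism alg_pi.
Proof. by split=> // x y; rewrite -alg_pi_mul. Qed.

HB.instance Definition _ :=
  GRing.isMonoidMorphism.Build A alg_quot alg_pi alg_pi_monoid_morphism.

Fact alg_pi_scalable : scalable alg_pi.
Proof. by move=> c x; rewrite -alg_pi_scale. Qed.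

HB.instance Definition _ :=
  GRing.isScalable.Build F A alg_quot *:%R alg_pi alg_pi_scalable.

End AlgQuotient.

Inductive ideal_gen (R : nzRingType) (G : R -> Prop) : R -> Prop :=
| IdealGen0 : ideal_gen G 0
| IdealGenD u g v x : G g -> ideal_gen G x -> ideal_gen G (u * g * v + x).

Section IdealGen.
Variables (R : nzRingType) (G : R -> Prop).

Lemma ideal_gen_add x y : ideal_gen G x -> ideal_gen G y -> ideal_gen G (x + y).
Proof.
elim=> [|u g v z Gg _ IH] Hy; first by rewrite add0r.
by rewrite -addrA; apply: IdealGenD => //; apply: IH.
Qed.

Lemma ideal_gen_mul w t x : ideal_gen G x -> ideal_gen G (w * x * t).
Proof.
elim=> [|u g v z Gg _ IH]; first by rewrite mulr0 mul0r; apply: IdealGen0.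
rewrite mulrDr mulrDl; have -> : w * (u * g * v) * t = (w * u) * g * (v * t).
  by rewrite !mulrA.
exact: IdealGenD.
Qed.

End IdealGen.

(* The free unital associative algebra on two generators is the monoid algebra
   of the free monoid on two letters. *)
Definition free_alg (F : fieldType) : Type := {malg F[{fmonom bool}]}.

Section FreeAlgebra.
Variable F : fieldType.

HB.instance Definition _ := GRing.Lalgebra.on (free_alg F).

Fact free_alg_scaleAr c (x y : free_alg F) : c *: (x * y) = x * (c *: y).
Proof.
rewrite -[c *: y]mul_malgC mulrA; have -> : x * c%:MP = c *: x; last exact: scalerAl.
rewrite malgM_def fgmulgU malgZ_def; apply: eq_bigr => k _.
by rewrite mulrC Monoid.mulm1.
Qed.

HB.instance Definition _ :=
  GRing.Lalgebra_isAlgebra.Build F (free_alg F) free_alg_scaleAr.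
End FreeAlgebra.

HB.lock Definition free_a (F : fieldType) : free_alg F := << fmu false >>.
HB.lock Definition free_b (F : fieldType) : free_alg F := << fmu true >>.

Section TripleSystem.
Variables (F : fieldType) (B : algType F).

Definition jordan (u v : B) : B := 2^-1 *: (u * v + v * u).

Definition omega (x y z : B) : B := jordan x y * z.
End TripleSystem.

Section Envelope.
Variable F : fieldType.

Definition e1 : 'M[F]_2 := delta_mx 0 1.
Definition e2 : 'M[F]_2 := delta_mx 1 0.

Definition zero_diag (m : 'M[F]_2) : Prop := forall i, m i i = 0.

Lemma zero_diagE m : zero_diag m -> m = m 0 1 *: e1 + m 1 0 *: e2.
Proof.
move=> m0; apply/matrixP => i j; rewrite !mxE.
have [->|->] : i = 0 \/ i = 1 by case: i => [[|[|//]] ?]; [left | right]; apply: val_inj.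
all: have [->|->] : j = 0 \/ j = 1 by case: j => [[|[|//]] ?]; [left | right]; apply: val_inj.
all: by rewrite ?m0 ?eqxx /= ?mulr1 ?mulr0 ?addr0 ?add0r.
Qed.

Lemma zero_diag_mul3 x y z :
  zero_diag x -> zero_diag y -> zero_diag z -> zero_diag (x * y * z).
Proof.
move=> x0 y0 z0 i; rewrite !mxE big_ord_recl big_ord1 !mxE.
rewrite !big_ord_recl !big_ord0.
have [->|->] : i = 0 \/ i = 1 by case: i => [[|[|//]] ?]; [left | right]; apply: val_inj.
all: have -> : lift ord0 ord0 = 1 :> 'I_2 by apply: val_inj.
all: by rewrite ?x0 ?y0 ?z0 ?(mulr0, mul0r, addr0).
Qed.

Lemma zero_diag_omega x y z :
  zero_diag x -> zero_diag y -> zero_diag z -> zero_diag (omega x y z).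
Proof.
move=> x0 y0 z0 i; rewrite /omega /jordan -scalerAl mulrDl mxE [X in _ * X]mxE.
by rewrite !zero_diag_mul3 // addr0 mulr0.
Qed.


(* Only used on matrices with zero diagonal, see [phi_e1], [phi_e2]
   and [zero_diagE]. *)
Definition phi (m : 'M[F]_2) : free_alg F := m 0 1 *: free_a F + m 1 0 *: free_b F.

Fact phi_is_linear : linear phi.
Proof.
move=> c x y; have E i j : (c *: x + y) i j = c * x i j + y i j.
  by rewrite !mxE.
rewrite /phi !E; move: (free_a F) (free_b F) => a b.
rewrite !scalerDl -!(scalerA c) scalerDr.
move: (x 0 1 *: _) (x 1 0 *: _) (y 0 1 *: _) (y 1 0 *: _) => p q r t.
by move: (c *: p) (c *: q) => p' q'; rewrite addrACA.
Qed.
HB.instance Definition _ :=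
  GRing.isLinear.Build F 'M[F]_2 (free_alg F) *:%R phi phi_is_linear.

Lemma phi_e1 : phi e1 = free_a F.
Proof. have E i j : e1 i j = ((i == 0) && (j == 1))%:R by rewrite mxE.
by rewrite /phi; move: (free_a F) (free_b F) => a b; rewrite !E /= scale1r scale0r addr0. Qed.

Lemma phi_e2 : phi e2 = free_b F.
Proof. have E i j : e2 i j = ((i == 1) && (j == 0))%:R by rewrite mxE.
by rewrite /phi; move: (free_a F) (free_b F) => a b; rewrite !E /= scale1r scale0r add0r. Qed.

Definition env_relator (g : free_alg F) : Prop :=
  exists x y z : 'M[F]_2,
    [/\ x \in [:: e1; e2], y \in [:: e1; e2], z \in [:: e1; e2]
      & g = omega (phi x) (phi y) (phi z) - phi (omega x y z)].

Definition env_ideal : {pred free_alg F} :=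
  fun g => `[< ideal_gen env_relator g >].

Lemma env_idealP g : reflect (ideal_gen env_relator g) (g \in env_ideal).
Proof. exact: asboolP. Qed.

(* Properness: the augmentation a, b |-> 0 kills all relators. *)
Definition eps (g : free_alg F) : F := mcoeff (@fmone bool) (g : {malg F[{fmonom bool}]}).

Fact epsM x y : eps (x * y) = eps x * eps y.
Proof. exact: (mcoeff1g_is_multiplicative _ _).1. Qed.

Fact epsD x y : eps (x + y) = eps x + eps y.
Proof. exact: mcoeffD. Qed.

Fact epsZ c x : eps (c *: x) = c * eps x.
Proof. exact: mcoeffZ. Qed.

Fact eps_gen i : eps << fmu i >> = 0.
Proof. by rewrite /eps mcoeffU -val_eqE /= /fmu /fmone !fmE. Qed.

Fact eps_phi m : eps (phi m) = 0.
Proof.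
rewrite /phi (_ : eps _ = m 0 1 * eps (free_a F) + m 1 0 * eps (free_b F)); last first.
  exact: etrans (epsD _ _) (congr2 +%R (epsZ _ _) (epsZ _ _)).
by rewrite free_a.unlock free_b.unlock !eps_gen !mulr0 addr0.
Qed.

Fact eps_relator g : env_relator g -> eps g = 0.
Proof.
move=> [x [y [z [_ _ _ ->]]]].
by rewrite -scaleN1r epsD epsZ eps_phi epsM eps_phi !mulr0 addr0.
Qed.

Fact env_ideal_eps g : g \in env_ideal -> eps g = 0.
Proof.
move=> /env_idealP; elim=> [|u r v x Gr _ IH]; first exact: mcoeff0.
by rewrite epsD IH !epsM (eps_relator Gr) mulr0 mul0r addr0.
Qed.

Fact env_ideal_closed : idealr_closed env_ideal.
Proof.
split; first by apply/env_idealP; apply: IdealGen0.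
  apply/negP => /env_ideal_eps /eqP.
  by rewrite /eps mcoeff1 eqxx oner_eq0.
move=> a u v /env_idealP Iu /env_idealP Iv; apply/env_idealP.
by apply: ideal_gen_add => //; rewrite -[_ * u]mulr1; apply: ideal_gen_mul.
Qed.
HB.instance Definition _ := isIdealr.Build (free_alg F) env_ideal env_ideal_closed.

Fact env_ideal_absorb_r : forall a, {in env_ideal, forall u, u * a \in env_ideal}.
Proof.
move=> a u /env_idealP Iu; apply/env_idealP.
by rewrite -[u]mul1r; apply: ideal_gen_mul.
Qed.
HB.instance Definition _ :=
  isRightAbsorbing.Build (free_alg F) env_ideal env_ideal_absorb_r.

Definition envelope : algType F := alg_quot env_ideal.

Definition env_a : envelope := alg_pi env_ideal (free_a F).
Definition env_b : envelope := alg_pi env_ideal (free_b F).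
End Envelope.

Arguments env_a {F}.
Arguments env_b {F}.

Section Basis.
Variables (F : fieldType) (V : lmodType F).

Definition lin_indep (s : seq V) : Prop :=
  forall c : 'I_(size s) -> F, \sum_i c i *: s`_i = 0 -> forall i, c i = 0.

Definition is_basis (S : {pred V}) (s : seq V) : Prop :=
  [/\ {subset s <= S}, lin_indep s
    & forall v, v \in S -> exists c : 'I_(size s) -> F, v = \sum_i c i *: s`_i].

Definition has_dim (S : {pred V}) (n : nat) : Prop :=
  exists2 s : seq V, size s = n & is_basis S s.

Definition direct_sum (R S : {pred V}) : Prop :=
  (forall v, exists r s, [/\ r \in R, s \in S & v = r + s]) /\
  (forall v, v \in R -> v \in S -> v = 0).
End Basis.

Section Radical.
Variables (F : fieldType) (A : algType F).

Definition nilpotent_ideal (J : tsideal A) : Prop :=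
  exists n, forall x : 'I_n -> A,
    (forall i, x i \in (J : {pred A})) -> \prod_(i < n) x i = 0.

(* The (Wedderburn) radical of a finite dimensional algebra: its largest
   nilpotent two-sided ideal. Restricting to proper ideals loses nothing since
   1 != 0 in A. *)
Definition is_radical (R : tsideal A) : Prop :=
  nilpotent_ideal R /\
  forall J : tsideal A, nilpotent_ideal J ->
    {subset (J : {pred A}) <= (R : {pred A})}.
End Radical.

Definition alg_iso (F : fieldType) (A B : algType F) : Prop :=
  exists f : {lrmorphism A -> B}, bijective f.

Definition iso_onto_subalg (F : fieldType) (A B : algType F) (S : {pred B})
    : Prop :=
  exists f : {lrmorphism A -> B},
    injective f /\ forall y, y \in S <-> exists x, f x = y.

(* 'End(V) carries no canonical ring structure (it is trivial when V = 0), so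
   multiplicativity is spelled out. *)
Record fdrep (F : fieldType) (A : algType F) := Fdrep {
  rep_space : vectType F;
  rep_map :> {linear A -> 'End(rep_space)};
  rep1 : rep_map 1 = \1%VF;
  repM : forall x y, rep_map (x * y) = (rep_map x \o rep_map y)%VF
}.

Section Representations.
Variables (F : fieldType) (A : algType F).

Definition rep_irreducible (r : fdrep A) : Prop :=
  (fullv : {vspace rep_space r}) <> 0%VS /\
  forall W : {vspace rep_space r},
    (forall x, (r x @: W <= W)%VS) -> W = 0%VS \/ W = fullv.

Definition rep_iso (r s : fdrep A) : Prop :=
  exists f : 'Hom(rep_space r, rep_space s),
    bijective f /\ forall x, (f \o r x)%VF = (s x \o f)%VF.
End Representations.

(* Main.v *)
(** Expanding the relators on the generators gives
      a^3 = a^2 b = b^2 a = b^3 = 0,  aba + ba^2 = a,  ab^2 + bab = b,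
    and reading the last two as rewrite rules for ba^2 and bab brings every word
    to one of the nine listed ones. These are independent because
    a = E_12 + E_23, b = E_21 + E_14 satisfy the relations in M_4(F).
    The morphism a |-> (0, E_12), b |-> (0, E_21) onto F x M_2(F) is split, with
    ab, aba, b - ab^2, ba as matrix units; its kernel, spanned by
    a^2, b^2, ab^2, a - aba, is killed by a and b on the right, hence squares to
    zero, and it is the radical since F x M_2(F) has no nilpotent ideal.
    On an irreducible module the common kernel of a^2 and b^2 contains the images
    of a and b, which forces a^2 = b^2 = 0. If a acts by 0, so does
    b = ab^2 + bab; otherwise any nonzero w = av spans with bw a copy of the
    natural module of M_2(F), and Schur's lemma concludes. *)
Require Import Defs.
From HB Require Import structures.
From mathcomp Require Import all_boot all_order all_algebra.
From mathcomp Require Import monalg.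

Set Implicit Arguments.
Unset Strict Implicit.
Unset Printing Implicit Defensive.

Import GRing.Theory.
Local Open Scope ring_scope.

(** * Evaluation of noncommutative polynomials *)

Section FreeEval.
Variables (F : fieldType) (B : algType F) (u v : B).

Definition word_eval (m : {fmonom bool}) : B :=
  \prod_(i <- (m : seq bool)) (if i then v else u).

Fact word_eval_mmorphism : mmorphism word_eval.
Proof.
by split=> [x y|]; rewrite /word_eval ?fmM ?big_cat //= fm1 big_nil.
Qed.
HB.instance Definition _ :=
  isMultiplicative.Build {fmonom bool} B word_eval word_eval_mmorphism.

Definition free_eval (g : free_alg F) : B := mmap (GRing.in_alg B) word_eval g.

Fact free_eval_zmod_morphism : zmod_morphism free_eval.
Proof. exact: mmapB. Qed.
HB.instance Definition _ :=
  GRing.isZmodMorphism.Build (free_alg F) B free_eval free_eval_zmod_morphism.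

Fact free_eval_monoid_morphism : monoid_morphism free_eval.
Proof.
(* The target is noncommutative; it suffices that coefficients commute with the values of words, and
   scalars are central. *)
have [g m m'|evM ev1] := @commr_mmap_is_multiplicative _ F B
  (GRing.in_alg B) word_eval.
  by rewrite /GRing.comm /= -scalerAl -scalerAr mul1r mulr1.
by split; [exact: ev1 | exact: evM].
Qed.
HB.instance Definition _ :=
  GRing.isMonoidMorphism.Build (free_alg F) B free_eval
    free_eval_monoid_morphism.

Fact free_eval_scalable : scalable free_eval.
Proof.
move=> c g; transitivity (GRing.in_alg B c * free_eval g); first exact: mmapZ.
by rewrite mulr_algl.
Qed.
HB.instance Definition _ :=
  GRing.isScalable.Build F (free_alg F) B *:%R free_eval free_eval_scalable.

Lemma free_eval_gen i : free_eval << fmu i >> = if i then v else u.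
Proof.
rewrite /free_eval mmapU /= scale1r mul1r /word_eval fmU.
by rewrite big_seq1.
Qed.

Lemma free_eval_a : free_eval (free_a F) = u.
Proof. by rewrite free_a.unlock free_eval_gen. Qed.

Lemma free_eval_b : free_eval (free_b F) = v.
Proof. by rewrite free_b.unlock free_eval_gen. Qed.

End FreeEval.

(** Every element is a finite combination of words, and a word is built by prepending one letter at
    a time. *)
Lemma free_ind (F : fieldType) (P : free_alg F -> Prop) :
  P 1 -> (forall x y, P x -> P y -> P (x + y)) ->
  (forall (c : F) x, P x -> P (c *: x)) ->
  (forall x, P x -> P (free_a F * x)) -> (forall x, P x -> P (free_b F * x)) ->
  forall x, P x.
Proof.
move=> P1 PD PZ Pa Pb x.
have P0 : P 0 by rewrite -(scale0r 1); apply: PZ.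
rewrite [x]monalgE; elim/big_ind: _ => // m _.
suff Pm : P << m >>.
  have -> : << x@_m *g m >> = x@_m *: (<< m >> : free_alg F); last exact: PZ.
  by apply/malgP => k; rewrite -[LHS]/(mcoeff _ _) mcoeffZ !mcoeffU mulr_natr.
case: m => s; elim: s => [|i s IH].
  suff -> : << FMonom [::] >> = 1 :> free_alg F by [].
  by rewrite -(fmoneE bool).
have -> : << FMonom (i :: s) >> = << fmu i >> * << FMonom s >> :> free_alg F.
  rewrite [RHS]malgM_def fgmulUU mulr1; congr << _ >>.
  by apply: val_inj; rewrite [RHS]fmM fmU.
case: i; [move: (Pb _ IH) | move: (Pa _ IH)].
  by rewrite free_b.unlock.
by rewrite free_a.unlock.
Qed.

(** * Quotients and the universal property of the envelope *)

Section Kernel.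
Variables (R S : nzRingType) (f : {rmorphism R -> S}).

Definition rker : {pred R} := fun x => f x == 0.

Lemma rkerE x : (x \in rker) = (f x == 0).
Proof. by []. Qed.

(** Properness holds because [f 1 = 1] is nonzero in [S]. *)
Fact rker_closed : idealr_closed rker.
Proof.
split; first by rewrite rkerE rmorph0.
  by rewrite rkerE rmorph1 oner_eq0.
move=> a u v; rewrite !rkerE => /eqP fu0 /eqP fv0.
by rewrite rmorphD rmorphM fu0 fv0 mulr0 addr0.
Qed.
HB.instance Definition _ := isIdealr.Build R rker rker_closed.

Fact rker_absorb_r : forall a, {in rker, forall u, u * a \in rker}.
Proof. by move=> a u; rewrite !rkerE rmorphM => /eqP ->; rewrite mul0r. Qed.
HB.instance Definition _ := isRightAbsorbing.Build R rker rker_absorb_r.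
End Kernel.

Section QuotLift.
Variables (F : fieldType) (A B : algType F) (I : tsideal A).
Variable f : {lrmorphism A -> B}.

Definition quot_lift (fI : {in (I : {pred A}), forall x, f x = 0})
  (q : alg_quot I) : B := f (alg_repr q).

Hypothesis fI : {in (I : {pred A}), forall x, f x = 0}.

Lemma quot_lift_pi x : quot_lift fI (alg_pi I x) = f x.
Proof.
apply/eqP; rewrite -subr_eq0 -rmorphB; apply/eqP/fI/alg_piP.
by rewrite alg_reprK.
Qed.

Fact quot_lift_zmod_morphism : zmod_morphism (quot_lift fI).
Proof.
move=> p q; rewrite -[p]alg_reprK -[q]alg_reprK -rmorphB.
by rewrite !quot_lift_pi rmorphB.
Qed.
HB.instance Definition _ := GRing.isZmodMorphism.Build (alg_quot I) B
  (quot_lift fI) quot_lift_zmod_morphism.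

Fact quot_lift_monoid_morphism : monoid_morphism (quot_lift fI).
Proof.
split; first by rewrite -(rmorph1 (@alg_pi F A I)) quot_lift_pi rmorph1.
move=> p q; rewrite -[p]alg_reprK -[q]alg_reprK -rmorphM.
by rewrite !quot_lift_pi rmorphM.
Qed.
HB.instance Definition _ := GRing.isMonoidMorphism.Build (alg_quot I) B
  (quot_lift fI) quot_lift_monoid_morphism.

Fact quot_lift_scalable : scalable (quot_lift fI).
Proof.
by move=> c q; rewrite -[q]alg_reprK -linearZ !quot_lift_pi linearZ.
Qed.
HB.instance Definition _ := GRing.isScalable.Build F (alg_quot I) B *:%R
  (quot_lift fI) quot_lift_scalable.
End QuotLift.

Lemma omega_morph (F : fieldType) (A B : algType F) (f : {lrmorphism A -> B})
  x y z : f (omega x y z) = omega (f x) (f y) (f z).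
Proof. by rewrite /omega /jordan rmorphM /= linearZ /= rmorphD !rmorphM. Qed.

Lemma mul_delta_mxE (F : fieldType) n (i j k l : 'I_n.+1) :
  delta_mx i j * delta_mx k l = delta_mx i l *+ (j == k) :> 'M[F]_n.+1.
Proof. exact: mul_delta_mx_cond. Qed.

Lemma omegaE (F : fieldType) (B : algType F) (x y z : B) :
  omega x y z = 2^-1 *: (x * y * z + y * x * z).
Proof. by rewrite /omega /jordan -scalerAl mulrDl. Qed.

(** [omega] is symmetric in its first two arguments, so the eight relators on the generators reduce
    to these six relations once the factor 1/2 is cleared. *)
Definition env_rel (F : fieldType) (B : algType F) (u v : B) : Prop :=
  [/\ u * u * u = 0, u * u * v = 0, v * v * u = 0 & v * v * v = 0] /\
  (u * v * u + v * u * u = u /\ u * v * v + v * u * v = v).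

Lemma ideal_gen_morph (R S : nzRingType) (f : {rmorphism R -> S})
  (G : R -> Prop) : (forall g, G g -> f g = 0) ->
  forall x, ideal_gen G x -> f x = 0.
Proof.
move=> fG x; elim=> [|u g v y Gg _ IH]; first exact: rmorph0.
by rewrite rmorphD IH !rmorphM (fG _ Gg) mulr0 mul0r addr0.
Qed.

Lemma ideal_gen_mem (R : nzRingType) (G : R -> Prop) g : G g -> ideal_gen G g.
Proof.
by move=> Gg; rewrite -[g]addr0 -[g]mul1r -[1 * g]mulr1; do 2?constructor.
Qed.

Section EnvLift.
Variables (F : fieldType) (B : algType F) (u v : B).
Hypothesis uv : env_rel u v.

(** [p] is [phi] with arbitrary [a] and [b] in place of the free generators. After transport to [B],
    each of the eight triples is settled by one relation of [env_rel]. *)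
Lemma env_relator_morph (A : algType F) (f : {lrmorphism A -> B}) (a b : A) :
  f a = u -> f b = v ->
  let p (m : 'M[F]_2) := m 0 1 *: a + m 1 0 *: b in
  forall x y z, x \in [:: e1 F; e2 F] -> y \in [:: e1 F; e2 F] ->
  z \in [:: e1 F; e2 F] -> f (omega (p x) (p y) (p z) - p (omega x y z)) = 0.
Proof.
move=> fa fb p x y z; have [[uuu uuv vvu vvv] [uvu uvv]] := uv.
have f_p m : f (p m) = m 0 1 *: u + m 1 0 *: v.
  by rewrite /p raddfD /= !linearZ /= fa fb.
rewrite raddfB /= omega_morph !f_p => mx my mz.
apply/eqP; rewrite subr_eq0; apply/eqP.
(* Triples with the first two arguments exchanged produce the summands in this order. *)
have vuu : v * u * u + u * v * u = u by rewrite addrC.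
have vuv : v * u * v + u * v * v = v by rewrite addrC.
move: mx my mz; rewrite !inE.
move=> /orP[] /eqP-> /orP[] /eqP-> /orP[] /eqP->.
all: rewrite !omegaE /e1 /e2 ?mul_delta_mxE /=.
all: rewrite ?(mul0r, mulr1n, mulr0n, addr0, add0r) ?mul_delta_mxE /= !mxE /=.
all: rewrite ?(mulr0, mulr1, scale0r, scale1r, addr0, add0r).
all: by rewrite ?uuu ?uuv ?vvu ?vvv ?uvu ?uvv ?vuu ?vuv ?addr0 ?scaler0.
Qed.

Lemma lrmorph_env_ideal (f : {lrmorphism free_alg F -> B}) :
  f (free_a F) = u -> f (free_b F) = v ->
  {in (@env_ideal F : {pred free_alg F}), forall g, f g = 0}.
Proof.
move=> fa fb g /env_idealP; apply: ideal_gen_morph.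
move=> h [x [y [z [mx my mz ->]]]].
exact: (env_relator_morph fa fb mx my mz).
Qed.

Definition env_lift : envelope F -> B := 
  quot_lift (lrmorph_env_ideal (free_eval_a u v) (free_eval_b u v)).
HB.instance Definition _ := GRing.LRMorphism.on env_lift.

Lemma env_lift_a : env_lift env_a = u.
Proof. exact: etrans (quot_lift_pi _ _) (free_eval_a u v). Qed.

Lemma env_lift_b : env_lift env_b = v.
Proof. exact: etrans (quot_lift_pi _ _) (free_eval_b u v). Qed.
End EnvLift.

(* Induction on words read from the left; it says that the words in [a] and [b]
   span [A], without quantifying over finite families. *)
Definition generated_by (F : fieldType) (A : algType F) (a b : A) : Prop :=
  forall P : A -> Prop, P 1 -> (forall x y, P x -> P y -> P (x + y)) ->
  (forall (c : F) x, P x -> P (c *: x)) ->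
  (forall x, P x -> P (a * x)) -> (forall x, P x -> P (b * x)) -> forall x, P x.

(** The property is pulled back along [f] and read at [g x], so [g] may be any set-theoretic
    section, such as [alg_repr] for the quotient. *)
Lemma generated_by_morph (F : fieldType) (A B : algType F)
  (f : {lrmorphism A -> B}) (g : B -> A) (a b : A) :
  cancel g f -> generated_by a b -> generated_by (f a) (f b).
Proof.
move=> gK genA P P1 PD PZ Pa Pb x; rewrite -[x]gK; move: (g x).
apply: genA => [|p q Pp Pq|c p Pp|p Pp|p Pp].
- by rewrite rmorph1.
- by rewrite raddfD; apply: PD.
- by rewrite linearZ; apply: PZ.
- by rewrite rmorphM; apply: Pa.
- by rewrite rmorphM; apply: Pb.
Qed.

Lemma env_ind (F : fieldType) : generated_by (@env_a F) env_b.
Proof.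
exact: (generated_by_morph (@alg_reprK F (free_alg F) (@env_ideal F))
  (@free_ind F)).
Qed.

(** Converse of [env_relator_morph]. Characteristic zero serves to divide by 2. *)
Lemma env_rel_morph (F : fieldType) (A B : algType F)
  (f : {lrmorphism A -> B}) (a b : A) :
  [pchar F] =i pred0 ->
  let p (m : 'M[F]_2) := m 0 1 *: a + m 1 0 *: b in
  (forall x y z, x \in [:: e1 F; e2 F] -> y \in [:: e1 F; e2 F] ->
    z \in [:: e1 F; e2 F] ->
    f (omega (p x) (p y) (p z) - p (omega x y z)) = 0) ->
  env_rel (f a) (f b).
Proof.
move=> charF p f0.
have n2 : 2 != 0 :> F by move/pcharf0P: charF => ->.
have f_p m : f (p m) = m 0 1 *: f a + m 1 0 *: f b.
  by rewrite /p raddfD /= !linearZ.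
have half : 2^-1 + 2^-1 = 1 :> F by rewrite -mulr2n -[_ *+ 2]mulr_natr mulVf.
have dbl (t : B) : 2^-1 *: (t + t) = t.
  by rewrite scalerDr -scalerDl half scale1r.
have [m1 m2] : e1 F \in [:: e1 F; e2 F] /\ e2 F \in [:: e1 F; e2 F].
  by rewrite !inE !eqxx orbT; split.
have rel x y z : x \in [:: e1 F; e2 F] -> y \in [:: e1 F; e2 F] ->
    z \in [:: e1 F; e2 F] ->
    omega (f (p x)) (f (p y)) (f (p z)) = f (p (omega x y z)).
  move=> mx my mz; apply/eqP; rewrite -subr_eq0 -omega_morph -raddfB /=.
  by rewrite f0.
(* One triple for each of the six relations. *)
have := (rel _ _ _ m1 m1 m1, rel _ _ _ m1 m1 m2, rel _ _ _ m2 m2 m1,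
  rel _ _ _ m2 m2 m2, rel _ _ _ m1 m2 m1, rel _ _ _ m1 m2 m2).
rewrite !f_p !omegaE /e1 /e2 !mul_delta_mxE /=.
rewrite ?(mul0r, mulr1n, mulr0n, addr0, add0r) ?mul_delta_mxE /=.
rewrite ?(addr0, add0r).
rewrite !mxE /= ?(mulr0, mulr1, scale0r, scale1r, addr0, add0r) !dbl.
move=> [[[[[aaa aab] bba] bbb] aba] abb].
have inj2 (s t : B) : 2^-1 *: s = 2^-1 *: t -> s = t.
  by apply: scalerI; rewrite invr_eq0.
by split; split => //; apply: inj2.
Qed.

Lemma env_relP (F : fieldType) (charF : [pchar F] =i pred0) :
  env_rel (@env_a F) env_b.
Proof.
apply: (@env_rel_morph F (free_alg F) (envelope F)
  (@alg_pi _ _ (@env_ideal F))) => // x y z mx my mz.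
apply: etrans (raddf0 (@alg_pi F (free_alg F) (@env_ideal F))); apply/alg_piP.
rewrite subr0; apply/env_idealP; apply: ideal_gen_mem.
by exists x, y, z.
Qed.

(** * Spans, matrix units and split extensions *)

Section Span.
Variables (F : fieldType) (V : lmodType F) (s : seq V).

Definition in_span (v : V) : Prop :=
  exists c : 'I_(size s) -> F, v = \sum_i c i *: s`_i.

Lemma in_span0 : in_span 0.
Proof. by exists (fun=> 0); rewrite big1 // => i _; rewrite scale0r. Qed.

Lemma in_spanD u v : in_span u -> in_span v -> in_span (u + v).
Proof.
move=> [c ->] [d ->]; exists (fun i => c i + d i).
by rewrite -big_split; apply: eq_bigr => i _; rewrite scalerDl.
Qed.

Lemma in_spanZ k v : in_span v -> in_span (k *: v).
Proof.
move=> [c ->]; exists (fun i => k * c i); rewrite scaler_sumr.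
by apply: eq_bigr => i _; rewrite scalerA.
Qed.

Lemma in_spanN v : in_span v -> in_span (- v).
Proof. by rewrite -scaleN1r; apply: in_spanZ. Qed.

Lemma mem_in_span v : v \in s -> in_span v.
Proof.
move=> sv; have lt_v : (index v s < size s)%N by rewrite index_mem.
exists (fun i => (i == Ordinal lt_v)%:R).
rewrite (bigD1 (Ordinal lt_v)) //= eqxx scale1r nth_index // big1 ?addr0 //.
by move=> i /negPf ->; rewrite scale0r.
Qed.

(** With coefficients indexed by natural numbers, unrolling a concrete sum leaves [c 0], [c 1] and
    so on instead of values at lifted ordinals. *)
Lemma lin_indepP :
  (forall c : nat -> F, \sum_(i < size s) c i *: s`_i = 0 ->
    forall i, (i < size s)%N -> c i = 0) -> lin_indep s.
Proof.
(* [d] extends [c] by zero past the end of [s]. *)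
move=> indep c c0 i; pose d k := if insub k is Some j then c j else 0.
have dE (j : 'I_(size s)) : d j = c j by rewrite /d valK.
rewrite -dE; apply: indep => //; rewrite -[RHS]c0.
by apply: eq_bigr => j _; rewrite dE.
Qed.
End Span.

Lemma in_span_linear (F : fieldType) (V W : lmodType F) (s : seq V) (t : seq W)
  (L : V -> W) v : linear L ->
  (forall u, u \in s -> in_span t (L u)) -> in_span s v -> in_span t (L v).
Proof.
move=> Llin; pose L' : {linear V -> W} :=
  HB.pack L (GRing.isLinear.Build F V W *:%R L Llin).
rewrite -[L]/(L' : V -> W) => Ls [c ->]; rewrite linear_sum.
elim/big_ind: _ => [||i _]; [exact: in_span0|exact: in_spanD|].
by rewrite linearZ; apply/in_spanZ/Ls/mem_nth.
Qed.

Section MatrixUnits.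
Variables (F : fieldType) (A : algType F) (n : nat).
Variable E : 'I_n.+1 -> 'I_n.+1 -> A.

(* The idempotent complementary to the matrix units carries the factor [F]. *)
Definition unit_section (x : (F^o * 'M[F]_n.+1)%type) : A :=
  (x.1 : F) *: (1 - \sum_i E i i) + \sum_i \sum_j x.2 i j *: E i j.

Fact unit_section_linear : linear unit_section.
Proof.
move=> c x y; rewrite /unit_section /=; move: (1 - _) => p.
rewrite scalerDl scalerDr -scalerA addrACA.
congr (_ + _); rewrite scaler_sumr -big_split; apply: eq_bigr => i _.
rewrite scaler_sumr -big_split; apply: eq_bigr => j _.
by rewrite !mxE scalerDl scalerA.
Qed.

Lemma unit_section_delta i j : unit_section (0, delta_mx i j) = E i j.
Proof.
rewrite /unit_section scale0r add0r (bigD1 i) //= (bigD1 j) //= mxE !eqxx.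
rewrite scale1r.
rewrite [X in _ + X + _]big1 => [|l /negPf nl]; last first.
  by rewrite mxE nl andbF scale0r.
rewrite big1 ?addr0 // => k /negPf nk; rewrite big1 // => l _.
by rewrite mxE nk scale0r.
Qed.

(** [f] sends [\sum_i E i i] to [(0, 1)], hence its complement to [(1, 0)], and the two components
    are recovered separately. *)
Lemma unit_sectionK (f : {lrmorphism A -> (F^o * 'M[F]_n.+1)%type}) :
  (forall i j, f (E i j) = (0, delta_mx i j)) -> cancel unit_section f.
Proof.
move=> fE [c X]; rewrite /unit_section raddfD /= linearZ /= rmorphB rmorph1 /=.
have sumE (X' : 'M[F]_n.+1) :
    f (\sum_i \sum_j X' i j *: E i j) = (0, X').
  rewrite [in RHS](matrix_sum_delta X') raddf_sum /=.
  elim/big_rec2: _ => // i M _ _ ->; rewrite raddf_sum /=.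
  have -> : \sum_j f (X' i j *: E i j) = (0, \sum_j X' i j *: delta_mx i j).
    elim/big_rec2: _ => // j N _ _ ->; rewrite linearZ /= fE.
    by apply: etrans (surjective_pairing _) _; rewrite /= scaler0 addr0.
  by apply: etrans (surjective_pairing _) _; rewrite /= addr0.
have -> : \sum_i E i i = \sum_i \sum_j (1%:M : 'M[F]_n.+1) i j *: E i j.
  apply: eq_bigr => i _; rewrite (bigD1 i) //= mxE eqxx scale1r big1 ?addr0 //.
  by move=> j /negPf nj; rewrite mxE eq_sym nj scale0r.
rewrite !sumE; apply: etrans (surjective_pairing _) _.
by rewrite /= subr0 addr0 subrr scaler0 add0r [_ *: _]mulr1.
Qed.

Hypothesis EE : forall i j k l, E i j * E k l = E i l *+ (j == k).

(** The complement [p] of the sum of the diagonal units is an idempotent whose products with all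
    units vanish on both sides, so the mixed terms drop out. *)
Fact unit_section_monoid_morphism : monoid_morphism unit_section.
Proof.
have sEE i j : (\sum_k E k k) * E i j = E i j.
  rewrite mulr_suml (bigD1 i) //= EE eqxx big1 ?addr0 // => k /negPf nk.
  by rewrite EE nk.
have EsE i j : E i j * (\sum_k E k k) = E i j.
  rewrite mulr_sumr (bigD1 j) //= EE eqxx big1 ?addr0 // => k /negPf nk.
  by rewrite EE eq_sym nk.
rewrite /unit_section; set p := 1 - _.
have pE i j : p * E i j = 0 by rewrite mulrBl mul1r sEE subrr.
have Ep i j : E i j * p = 0 by rewrite mulrBr mulr1 EsE subrr.
have pp : p * p = p.
  by rewrite {2}/p mulrBr mulr1 mulr_sumr big1 ?subr0 // => i _; rewrite pE.
split=> [|x y].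
  rewrite scale1r -[RHS](subrK (\sum_i E i i)); congr (_ + _).
  apply: eq_bigr => i _.
  rewrite (bigD1 i) //= mxE eqxx scale1r big1 ?addr0 // => j /negPf.
  by rewrite mxE eq_sym => ->; rewrite scale0r.
rewrite mulrDl !mulrDr.
rewrite -!scalerAl -scalerAr pp scalerA mulr_sumr mulr_suml.
have -> : \sum_i p * (\sum_j y.2 i j *: E i j) = 0.
  rewrite big1 // => i _; rewrite mulr_sumr big1 // => j _.
  by rewrite -scalerAr pE scaler0.
have -> : \sum_i (\sum_j x.2 i j *: E i j) * (y.1 *: p) = 0.
  rewrite big1 // => i _; rewrite mulr_suml big1 // => j _.
  by rewrite -scalerAl -scalerAr Ep !scaler0.
rewrite scaler0 addr0 add0r; congr (_ + _); rewrite mulr_suml.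
apply: eq_bigr => i _; rewrite mulr_suml.
transitivity (\sum_l \sum_j x.2 i j *: E i j * (y.2 j l *: E j l)).
  apply: eq_bigr => l _; rewrite mxE scaler_suml; apply: eq_bigr => j _.
  by rewrite -scalerAl -scalerAr EE eqxx scalerA.
rewrite exchange_big; apply: eq_bigr => j _; rewrite mulr_sumr.
rewrite [RHS](bigD1 j) //= [X in _ + X]big1 ?addr0 => [|k /negPf nkj].
  by rewrite mulr_sumr.
rewrite mulr_sumr big1 // => l _.
by rewrite -scalerAl -scalerAr EE eq_sym nkj !scaler0.
Qed.
End MatrixUnits.

Section SplitKernel.
Variables (F : fieldType) (A B : algType F).
Variables (f : {lrmorphism A -> B}) (g : {lrmorphism B -> A}).
Hypothesis gK : cancel g f.

Let R : tsideal A := rker f.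

Let f_ker : {in (R : {pred A}), forall x, f x = 0}.
Proof. by move=> x /eqP. Qed.

Let qf : {lrmorphism alg_quot R -> B} := quot_lift f_ker.

Let qf_bij : bijective qf.
Proof.
exists (@alg_pi F A R \o g) => [q|y] /=; last by rewrite quot_lift_pi gK.
rewrite -[q]alg_reprK quot_lift_pi; apply/alg_piP.
by rewrite rkerE rmorphB /= gK subrr.
Qed.

Lemma alg_iso_ker : alg_iso (alg_quot R) B.
Proof. by exists qf. Qed.

Lemma split_subalg : exists S : {pred A},
  [/\ GRing.subalg_closed S, direct_sum (R : {pred A}) S
    & iso_onto_subalg (alg_quot R) S].
Proof.
(* The image of [g], written as the fixed points of the idempotent endomorphism [g \o f] to make
   membership boolean. *)
pose S : {pred A} := fun x => g (f x) == x.
have SP x : reflect (g (f x) = x) (x \in S) by apply: eqP.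
exists S; split.
- split=> [|c x y /SP xS /SP yS|x y /SP xS /SP yS]; apply/SP.
  + by rewrite !rmorph1.
  + by rewrite !linearP /= xS yS.
  + by rewrite !rmorphM /= xS yS.
- split=> [v|v]; last by rewrite rkerE => /eqP fv /SP <-; rewrite fv rmorph0.
  exists (v - g (f v)), (g (f v)); split; last by rewrite subrK.
    by rewrite rkerE rmorphB /= gK subrr.
  by apply/SP; rewrite gK.
- exists (g \o qf); split=> [|y].
    exact: inj_comp (can_inj gK) (bij_inj qf_bij).
  split=> [/SP yS|[x <-]]; last by apply/SP; rewrite /= gK.
  by exists (alg_pi R y); rewrite /= quot_lift_pi.
Qed.
End SplitKernel.

(** Isolates one entry of [M]: a two-sided ideal containing [M] contains this multiple of every
    matrix unit. *)
Lemma delta_mx_sandwich (F : fieldType) (n : nat) (M : 'M[F]_n.+1) i j k l :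
  delta_mx k i * M * delta_mx j l = M i j *: delta_mx k l.
Proof.
have EE i' j' : delta_mx k i * (M i' j' *: delta_mx i' j') * delta_mx j l =
    M i' j' *: delta_mx k l *+ (i == i') *+ (j' == j).
  rewrite -scalerAr -scalerAl mul_delta_mxE mulrnAl mul_delta_mxE.
  by rewrite !scalerMnr -!mulrnA mulnC.
rewrite {1}[M]matrix_sum_delta mulr_sumr mulr_suml (bigD1 i) //=.
rewrite [X in _ + X]big1 ?addr0 => [|i' /negPf ni].
  rewrite mulr_sumr mulr_suml (bigD1 j) //= [X in _ + X]big1 ?addr0.
    by rewrite EE !eqxx.
  by move=> j' /negPf nj; rewrite EE nj.
by rewrite mulr_sumr mulr_suml big1 // => j' _; rewrite EE eq_sym ni mul0rn.
Qed.

(** The kernel squares to zero by hypothesis. Conversely, if [x] lies in a nilpotent ideal, every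
    [u * x * v] has nilpotent image. This kills the component in [F]; sandwiching between lifted
    matrix units makes each entry of the matrix component a nilpotent scalar. *)
Lemma radical_ker (F : fieldType) (A : algType F) (n : nat)
  (f : {lrmorphism A -> (F^o * 'M[F]_n.+1)%type}) (g : _ -> A) :
  cancel g f -> (forall x y, f x = 0 -> f y = 0 -> x * y = 0) ->
  is_radical (rker f : tsideal A).
Proof.
move=> gK RR; split.
  exists 2 => x Rx; rewrite !big_ord_recl big_ord0 mulr1.
  by apply: RR; apply/eqP; apply: Rx.
move=> J [m Jm] x Jx.
have pow_eq0 u v : f (u * x * v) ^+ m = 0.
  rewrite -rmorphXn -[X in _ ^+ X]card_ord -prodr_const Jm ?rmorph0 // => i.
  by apply/absorb_r/idealMr.
have expE (y : (F^o * 'M[F]_n.+1)%type) k : y ^+ k = (y.1 ^+ k, y.2 ^+ k).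
  by elim: k => [|k IH] //; rewrite exprS IH !exprS.
have f1 : (f x).1 = 0.
  have /(congr1 fst)/eqP := pow_eq0 1 1.
  by rewrite mul1r mulr1 expE /= expf_eq0 => /andP[_ /eqP].
suff f2 : (f x).2 = 0 
  by apply/eqP/(etrans (surjective_pairing (f x)) (congr2 pair f1 f2)).
apply/matrixP => i j; rewrite mxE.
have /(congr1 snd) := pow_eq0 (g (0, delta_mx 0 i)) (g (0, delta_mx j 0)).
rewrite !rmorphM /= !gK expE /= delta_mx_sandwich exprZn => /matrixP/(_ 0 0).
(* [m] may be zero, where the power is the identity; otherwise [delta_mx 0 0] is idempotent. *)
have d00 : (delta_mx 0 0 ^+ m : 'M[F]_n.+1) 0 0 = 1.
  case: (m) => [|k]; first by rewrite mxE.
  suff -> : delta_mx 0 0 ^+ k.+1 = delta_mx 0 0 :> 'M[F]_n.+1 by rewrite mxE.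
  by elim: k => // k IH; rewrite exprS IH mul_delta_mxE.
rewrite mxE d00 mulr1 mxE => /eqP; rewrite expf_eq0.
by case/andP=> _ /eqP.
Qed.

(** * The algebra defined by the relations *)

Section Structure.
Variables (F : fieldType) (A : algType F) (a b : A).
Hypothesis ab_rel : env_rel a b.

Let aaa : a * a * a = 0. Proof. by case: ab_rel => [[]]. Qed.
Let aab : a * a * b = 0. Proof. by case: ab_rel => [[]]. Qed.
Let bba : b * b * a = 0. Proof. by case: ab_rel => [[]]. Qed.
Let bbb : b * b * b = 0. Proof. by case: ab_rel => [[]]. Qed.
Let baa : b * a * a = a - a * b * a.
Proof.
by case: ab_rel => _ [h _]; apply/eqP; rewrite eq_sym subr_eq addrC h.
Qed.
Let bab : b * a * b = b - a * b * b.
Proof.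
by case: ab_rel => _ [_ h]; apply/eqP; rewrite eq_sym subr_eq addrC h.
Qed.

Let taaa t : t * a * a * a = 0.
Proof. by rewrite -!mulrA (mulrA a) aaa mulr0. Qed.
Let taab t : t * a * a * b = 0.
Proof. by rewrite -!mulrA (mulrA a) aab mulr0. Qed.
Let tbba t : t * b * b * a = 0.
Proof. by rewrite -!mulrA (mulrA b) bba mulr0. Qed.
Let tbbb t : t * b * b * b = 0.
Proof. by rewrite -!mulrA (mulrA b) bbb mulr0. Qed.
Let tbaa t : t * b * a * a = t * a - t * a * b * a.
Proof. by rewrite -!mulrA (mulrA b) baa mulrBr -!mulrA. Qed.
Let tbab t : t * b * a * b = t * b - t * a * b * b.
Proof. by rewrite -!mulrA (mulrA b) bab mulrBr -!mulrA. Qed.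

(* After reassociation to the left, a word only needs to be rewritten at its
   head or behind a prefix [t]. *)
Let norm := (expr2, mulrBl, mulrBr, mulrA, aaa, aab, bba, bbb, taaa, taab, tbba,
  tbbb, baa, bab, tbaa, tbab, mul0r, mulr0, mul1r, mulr1, subr0, sub0r, subrr,
  oppr0).

Definition std_basis : seq A :=
  [:: 1; a; b; a ^+ 2; a * b; b * a; b ^+ 2; a * b * a; a * b ^+ 2].

Definition std_table : seq (A * A * A) :=
  [:: (a, a, a ^+ 2); (a, b, a * b); (a, b * a, a * b * a);
      (a, b ^+ 2, a * b ^+ 2);
      (b, a, b * a); (b, b, b ^+ 2); (b, a ^+ 2, a - a * b * a);
      (b, a * b, b - a * b ^+ 2); (b, a * b * a, b * a);
      (b, a * b ^+ 2, b ^+ 2);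
      (a * b, a, a * b * a); (a * b, b, a * b ^+ 2);
      (a * b, a ^+ 2, a ^+ 2); (a * b, a * b, a * b);
      (a * b, a * b * a, a * b * a); (a * b, a * b ^+ 2, a * b ^+ 2);
      (b * a, a, a - a * b * a); (b * a, b, b - a * b ^+ 2);
      (b * a, b * a, b * a); (b * a, b ^+ 2, b ^+ 2);
      (a * b * a, a, a ^+ 2); (a * b * a, b, a * b);
      (a * b * a, b * a, a * b * a); (a * b * a, b ^+ 2, a * b ^+ 2)].

Lemma std_tableP x y z : (x, y, z) \in std_table -> x * y = z.
Proof.
have tabE : all (fun t => t.1.1 * t.1.2 == t.2) std_table.
  by rewrite /= !norm !eqxx.
by move=> /(allP tabE) /eqP.
Qed.

Lemma std_table0 x y :
  x \in behead std_basis -> y \in behead std_basis ->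
  (x, y) \notin [seq t.1 | t <- std_table] -> x * y = 0.
Proof.
rewrite [behead _]/= => xs ys; move: xs ys; rewrite !inE.
(* There are 64 pairs: either the product normalises to zero or the pair is in the table. *)
do 7?[case/orP]; move/eqP->; do 7?[case/orP]; move/eqP-> => notin.
all: first [by rewrite !norm | by case/negP: notin; rewrite /= eqxx ?orbT].
Qed.

(** Here [a] and [b] are corrected by the radical elements [a - a * b * a] and [a * b ^+ 2], so that
    the matrix unit relations hold exactly in [A]. *)
Definition std_unit (i j : 'I_2) : A :=
  if i == 0 then if j == 0 then a * b else a * b * a
  else if j == 0 then b - a * b ^+ 2 else b * a.

Lemma std_unitM i j k l :
  std_unit i j * std_unit k l = std_unit i l *+ (j == k).
Proof.
move: i j k l; do 4?case=> [[|[|//]] ?].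
all: by rewrite /std_unit /= ?mulr1n ?mulr0n !norm.
Qed.

Let g := unit_section std_unit.
HB.instance Definition _ := GRing.isLinear.Build F (F^o * 'M[F]_2)%type A *:%R g
  (unit_section_linear std_unit).
HB.instance Definition _ :=
  GRing.isMonoidMorphism.Build (F^o * 'M[F]_2)%type A g
  (unit_section_monoid_morphism std_unitM).

Hypothesis ab_gen : generated_by a b.

(** The span contains 1 and is stable under left multiplication by the generators: [a] sends a
    listed word to zero or to a listed word, [b] possibly to a difference of two. *)
Lemma std_basis_span x : in_span std_basis x.
Proof.
have lmul_lin (u : A) : linear ( *%R u).
  by move=> c y z; rewrite mulrDr scalerAr.
elim/ab_gen: x => [|x y|c x|x|x].
- exact: mem_in_span (mem_head _ _).
- exact: in_spanD.
- exact: in_spanZ.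
- apply: in_span_linear => // u; rewrite !inE.
  do 8?[case/orP]; move/eqP->; rewrite ?norm; first
    [exact: in_span0 | by apply: mem_in_span; rewrite !inE !norm eqxx ?orbT].
- apply: in_span_linear => // u; rewrite !inE.
  do 8?[case/orP]; move/eqP->; rewrite ?norm; first
    [exact: in_span0 | by apply: mem_in_span; rewrite !inE !norm eqxx ?orbT
    | by apply: in_spanD; [|apply: in_spanN]; apply: mem_in_span;
      rewrite !inE !norm eqxx ?orbT].
Qed.

Variable f : {lrmorphism A -> (F^o * 'M[F]_2)%type}.
Hypotheses (fa : f a = (0, delta_mx 0 1)) (fb : f b = (0, delta_mx 1 0)).

Let pair0M (X Y : 'M[F]_2) :
  ((0, X) : (F^o * 'M[F]_2)%type) * (0, Y) = (0, X * Y).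
Proof. by apply: etrans (surjective_pairing _) _; rewrite /= mul0r. Qed.

Lemma std_splitK : cancel g f.
Proof.
apply: unit_sectionK => i j.
have [ab ba] : f (a * b) = (0, delta_mx 0 0) /\ f (b * a) = (0, delta_mx 1 1).
  by rewrite !rmorphM /= fa fb !pair0M !mul_delta_mxE.
have aba : f (a * b * a) = (0, delta_mx 0 1).
  by rewrite rmorphM /= ab fa pair0M mul_delta_mxE.
have abb : f (a * b ^+ 2) = 0.
  by rewrite expr2 mulrA rmorphM /= ab fb pair0M mul_delta_mxE.
move: i j; do 2?case=> [[|[|//]] ?]; rewrite /std_unit /=.
- by rewrite ab; congr (_, delta_mx _ _); apply: val_inj.
- by rewrite aba; congr (_, delta_mx _ _); apply: val_inj.
- by rewrite rmorphB /= abb fb subr0; congr (_, delta_mx _ _); apply: val_inj.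
- by rewrite ba; congr (_, delta_mx _ _); apply: val_inj.
Qed.

Definition rad_basis : seq A := [:: a ^+ 2; b ^+ 2; a * b ^+ 2; a - a * b * a].

(** Since [g] is a section, it suffices that [g (f u)] vanishes. This is computed in [A], where the
    relations reduce expressions in [a * b * a] and [b - a * b ^+ 2]. *)
Lemma rad_basis_ker u : u \in rad_basis -> f u = 0.
Proof.
have gfa : g (f a) = a * b * a by rewrite fa [g _]unit_section_delta.
have gfb : g (f b) = b - a * b ^+ 2 by rewrite fb [g _]unit_section_delta.
move=> uR; rewrite -(std_splitK (f u)).
have -> : g (f u) = 0; last exact: rmorph0.
move: uR; rewrite !inE; do 3?[case/orP]; move/eqP->.
all: rewrite ?(rmorphB, rmorphXn, rmorphM) /= ?(rmorphB, rmorphXn, rmorphM) /=.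
all: by rewrite ?gfa ?gfb !norm.
Qed.

(** The projection [x - g (f x)] fixes the kernel and sends each standard basis element to zero or
    to an element of [rad_basis]. *)
Lemma rad_basis_span x : f x = 0 -> in_span rad_basis x.
Proof.
have gfa : g (f a) = a * b * a by rewrite fa [g _]unit_section_delta.
have gfb : g (f b) = b - a * b ^+ 2 by rewrite fb [g _]unit_section_delta.
move=> fx; rewrite -[x]subr0 -(rmorph0 g) -fx.
apply: (in_span_linear (L := fun x => x - g (f x))) (std_basis_span x).
  move=> c y z; have -> : g (f (c *: y + z)) = c *: g (f y) + g (f z).
    by rewrite (linearP f) (linearP g).
  by rewrite scalerBr opprD addrACA.
move=> u; rewrite !inE; do 8?[case/orP]; move/eqP->.
all: rewrite ?(rmorph1, rmorphB, rmorphXn, rmorphM) /=.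
all: rewrite ?(rmorph1, rmorphB, rmorphXn, rmorphM) /=.
all: rewrite ?gfa ?gfb ?norm ?subKr; first
  [exact: in_span0 | by apply: mem_in_span; rewrite !inE !norm eqxx ?orbT].
Qed.

(** An element killed by [a] and [b] on the right is multiplied by any [z] through the scalar
    [(f z).1], which is zero on the kernel. *)
Lemma rad_mul0 x y : f x = 0 -> f y = 0 -> x * y = 0.
Proof.
move=> fx fy.
have ann u : u * a = 0 -> u * b = 0 -> forall z, u * z = (f z).1 *: u.
  move=> ua ub; elim/ab_gen => [|z t IHz IHt|c z IH|z _|z _].
  - by rewrite rmorph1 mulr1 scale1r.
  - by rewrite raddfD mulrDr IHz IHt scalerDl.
  - by rewrite linearZ -scalerAr IH scalerA.
  - by rewrite mulrA ua rmorphM /= fa !mul0r scale0r.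
  - by rewrite mulrA ub rmorphM /= fb !mul0r scale0r.
have rad_ann u : u \in rad_basis -> u * a = 0 /\ u * b = 0.
  by rewrite !inE; do 3?[case/orP]; move/eqP->; rewrite !norm.
have [c ->] := rad_basis_span fx.
rewrite mulr_suml big1 // => i _; rewrite -scalerAl.
have [ua ub] := rad_ann _ (mem_nth 0 (ltn_ord i)).
by rewrite (ann _ ua ub) fy scale0r scaler0.
Qed.

End Structure.

(** * Linear independence through a four-dimensional representation *)

Section Independence.
Variables (F : fieldType) (A : algType F) (a b : A).
Variable r : {lrmorphism A -> 'M[F]_4}.
Hypotheses (ra : r a = delta_mx 0 1 + delta_mx 1 2).
Hypotheses (rb : r b = delta_mx 1 0 + delta_mx 0 3).

Let monomE : [/\ r (a ^+ 2) = delta_mx 0 2, r (a * b) = delta_mx 0 0,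
  r (b * a) = delta_mx 1 1, r (b ^+ 2) = delta_mx 1 3 & 
  r (a * b * a) = delta_mx 0 1 /\ r (a * b ^+ 2) = delta_mx 0 3].
Proof.
rewrite !expr2 mulrA !rmorphM /= ra rb.
by split; last split; do 2!rewrite ?mulrDl ?mulrDr ?mul_delta_mxE /=
  ?(mulr1n, mulr0n, mul0r, addr0, add0r).
Qed.

Lemma std_basis_indep : lin_indep (std_basis a b).
Proof.
apply: lin_indepP => c /(congr1 r); rewrite linear0 linear_sum /=.
have [raa rab rba rbb [raba rabb]] := monomE.
rewrite !big_ord_recl big_ord0 /= !linearZ /= rmorph1 ra rb.
rewrite raa rab rba rbb raba rabb.
rewrite /bump /= => /matrixP E; have {}E i j := E i j.
have {}E (i j : 'I_4) : let d (k l : 'I_4) : F := ((i == k) && (j == l))%:R in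
    c 0%N * (i == j)%:R + (c 1%N * (d 0 1 + d 1 2) + (c 2%N * (d 1 0 + d 0 3) +
    (c 3%N * d 0 2 + (c 4%N * d 0 0 + (c 5%N * d 1 1 + (c 6%N * d 1 3 +
    (c 7%N * d 0 1 + c 8%N * d 0 3))))))) = 0.
  by have := E i j; rewrite !mxE addr0.
(* Each of these entries involves a single coefficient. Once [c 0], [c 1] and [c 2] vanish, the next
   four entries isolate the remaining ones. *)
have := (E 2 2, E 1 2, E 1 0, E 0 2, E 1 3).
rewrite /= !(mulr0, mulr1, addr0, add0r) => -[[[[c0 c1] c2] c3] c6].
have := (E 0 0, E 1 1, E 0 1, E 0 3).
rewrite /= c0 c1 c2 !(mulr0, mulr1, addr0, add0r) => -[[[c4 c5] c7] c8].
by do 9?[case=> //].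
Qed.

Lemma rad_basis_indep : lin_indep (rad_basis a b).
Proof.
apply: lin_indepP => c /(congr1 r); rewrite linear0 linear_sum /=.
have [raa rab rba rbb [raba rabb]] := monomE.
rewrite !big_ord_recl big_ord0 /= !linearZ /= rmorphB /= ra raa rbb raba rabb.
rewrite /bump /= => /matrixP E.
have := (E 0 2, E 1 3, E 0 3, E 1 2).
rewrite !mxE /= !(mulr0, mulr1, addr0, add0r, subr0) => -[[[c0 c1] c2] c3].
by do 4?[case=> //].
Qed.
End Independence.

Lemma env_rel_pair (F : fieldType) :
  env_rel ((0, delta_mx 0 1) : (F^o * 'M[F]_2)%type) (0, delta_mx 1 0).
Proof.
by split; split; apply: etrans (surjective_pairing _) _; rewrite /=
  !mul_delta_mxE /= ?mulr1n ?mul_delta_mxE !(mulr0, mul0r, addr0, add0r).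
Qed.

(** The first two basis vectors span the natural module of the 2 by 2 matrices, and the other two
    are mapped into it, which makes [a ^+ 2] and [b ^+ 2] act nontrivially. *)
Lemma env_rel_mx4 (F : fieldType) :
  env_rel (delta_mx 0 1 + delta_mx 1 2 : 'M[F]_4) (delta_mx 1 0 + delta_mx 0 3).
Proof.
split; split; do 3!rewrite ?(mulrDl, mulrDr) ?mul_delta_mxE /=
  ?(mulr1n, mulr0n, addr0, add0r, mul0r, mulr0).
all: by rewrite // addrC.
Qed.

(** * Representations *)

Section MatrixRep.
Variables (F : fieldType) (A : algType F) (n : nat).
Variable f : {lrmorphism A -> 'M[F]_n.+1}.

Definition mx_rep_map (x : A) : 'End('cV[F]_n.+1) := linfun (mulmx (f x)).

Lemma mx_rep_mapE x v : mx_rep_map x v = f x *m v.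
Proof. by rewrite lfunE. Qed.

Fact mx_rep_map_linear : linear mx_rep_map.
Proof.
move=> c x y; apply/lfunP => v; rewrite add_lfunE scale_lfunE !mx_rep_mapE.
by rewrite linearP mulmxDl scalemxAl.
Qed.
HB.instance Definition _ := GRing.isLinear.Build F A 'End('cV[F]_n.+1) *:%R
  mx_rep_map mx_rep_map_linear.

Fact mx_rep_map1 : mx_rep_map 1 = \1%VF.
Proof. by apply/lfunP => v; rewrite mx_rep_mapE rmorph1 mul1mx id_lfunE. Qed.

Fact mx_rep_mapM x y : mx_rep_map (x * y) = (mx_rep_map x \o mx_rep_map y)%VF.
Proof. by apply/lfunP => v; rewrite comp_lfunE !mx_rep_mapE rmorphM mulmxA. Qed.

Definition mx_rep : fdrep A := Fdrep mx_rep_map1 mx_rep_mapM.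

(** As [f] is onto, matrix units move a nonzero coordinate of a vector of [W] to any position, which
    puts the standard basis in [W]. *)
Lemma mx_rep_irreducible (g : 'M[F]_n.+1 -> A) : cancel g f ->
  rep_irreducible mx_rep.
Proof.
move=> gK; split.
  by apply/eqP; rewrite -dimv_eq0 dimvf dim_matrix.
move=> W Winv; have [->|W0] := eqVneq W 0%VS; [by left | right].
have [i vi] : exists i, vpick W i 0 != 0.
  apply/existsP; apply: contraNT W0 => /existsPn v0; rewrite -vpick0.
  apply/eqP/colP => i; rewrite mxE; apply/eqP.
  by have := v0 i; rewrite negbK.
have We k : delta_mx k 0 \in W.
  have /subvP/(_ _ (memv_img _ (memv_pick W))) := Winv (g (delta_mx k i)).
  rewrite /= mx_rep_mapE gK.
  have -> : delta_mx k i *m vpick W = vpick W i 0 *: delta_mx k 0.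
    apply/colP => l; rewrite !mxE (bigD1 i) //= mxE eqxx !andbT mulrC.
    rewrite big1 ?addr0 //.
    by move=> j /negPf nj; rewrite mxE nj andbF mul0r.
  by move/(memvZ (vpick W i 0)^-1); rewrite scalerA mulVf // scale1r.
apply/eqP; rewrite eqEsubv subvf; apply/subvP => v _.
rewrite [v]matrix_sum_delta; apply: memv_suml => k _.
by rewrite big_ord1 memvZ.
Qed.
End MatrixRep.

(** * Schur's lemma and the classification of irreducible modules *)

Section Schur.
Variables (F : fieldType) (A : algType F).
Implicit Types r s : fdrep A.

Definition rep_morph r s (f : 'Hom(rep_space r, rep_space s)) : Prop :=
  forall x, (f \o r x)%VF = (s x \o f)%VF.

Lemma rep_morphE r s (f : 'Hom(rep_space r, rep_space s)) :
  rep_morph f -> forall x v, f (r x v) = s x (f v).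
Proof. by move=> fM x v; rewrite -!comp_lfunE fM. Qed.

Lemma rep_repM r x y v : r (x * y) v = r x (r y v).
Proof. by rewrite repM comp_lfunE. Qed.

Lemma rep_schur r s (f : 'Hom(rep_space r, rep_space s)) :
  rep_irreducible r -> rep_irreducible s -> rep_morph f -> f != 0 ->
  rep_iso r s.
Proof.
move=> [_ r_irr] [_ s_irr] fM f0; exists f; split=> //.
have kf : lker f == 0%VS.
  have [|->|kf] := r_irr (lker f); [|by []|].
    move=> x; apply/subvP => _ /memv_imgP[v + ->]; rewrite !memv_ker.
    by rewrite rep_morphE // => /eqP ->; rewrite linear0.
  case/eqP: f0; apply/lfunP => v; rewrite zero_lfunE; apply/eqP.
  by rewrite -memv_ker kf memvf.
have imf : limg f = fullv.
  have [|im0|//] := s_irr (limg f).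
    move=> x; apply/subvP => _ /memv_imgP[_ /memv_imgP[v _ ->] ->].
    by rewrite -rep_morphE // memv_img // memvf.
  case/eqP: f0; apply/lfunP => v; rewrite zero_lfunE; apply/eqP.
  by rewrite -memv0 -im0 memv_img // memvf.
exists f^-1%VF; first exact: lker0_lfunK.
by move=> v; apply: limg_lfunVK; rewrite imf memvf.
Qed.

Lemma rep_iso_sym r s : rep_iso r s -> rep_iso s r.
Proof.
move=> [f [f_bij fM]]; have kf : lker f == 0%VS by apply/lker0P/bij_inj.
have fK := lker0_lfunK kf.
have fVK : cancel f^-1%VF f 
  by have [h _ hK] := f_bij => v; rewrite -[v]hK fK.
exists f^-1%VF; split; first by exists f.
move=> x; apply/lfunP => v; rewrite !comp_lfunE.
by rewrite -{1}[v]fVK -(rep_morphE fM) fK.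
Qed.

Lemma rep_iso_dim r s : rep_iso r s -> dim (rep_space r) = dim (rep_space s).
Proof.
move=> [f [f_bij _]]; have kf : lker f == 0%VS by apply/lker0P/bij_inj.
have imf : limg f = fullv.
  apply/eqP; rewrite eqEsubv subvf; apply/subvP => v _.
  by have [g _ gK] := f_bij; rewrite -[v]gK memv_img // memvf.
rewrite -!dimvf -imf limg_dim_eq //; apply/eqP.
by rewrite (eqP kf) capv0.
Qed.

Variables a b : A.
Hypothesis ab_gen : generated_by a b.

Lemma generated_rep_morph r s (f : 'Hom(rep_space r, rep_space s)) :
  (forall v, f (r a v) = s a (f v)) -> (forall v, f (r b v) = s b (f v)) ->
  rep_morph f.
Proof.
move=> fa fb x; apply/lfunP => v; rewrite !comp_lfunE; move: v.
elim/ab_gen: x => [|x y IHx IHy|c x IH|x IH|x IH] v.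
- by rewrite !rep1 !id_lfunE.
- by rewrite !linearD /= !add_lfunE linearD /= IHx IHy.
- by rewrite !linearZ /= !scale_lfunE linearZ /= IH.
- by rewrite !rep_repM fa IH.
- by rewrite !rep_repM fb IH.
Qed.

Lemma generated_stable r (W : {vspace rep_space r}) :
  (forall v, v \in W -> r a v \in W) -> (forall v, v \in W -> r b v \in W) ->
  forall x, (r x @: W <= W)%VS.
Proof.
move=> Wa Wb x; apply/subvP => _ /memv_imgP[v + ->]; move: v.
elim/ab_gen: x => [|x y IHx IHy|c x IH|x IH|x IH] v Wv.
- by rewrite rep1 id_lfunE.
- by rewrite linearD add_lfunE memvD ?IHx ?IHy.
- by rewrite linearZ scale_lfunE memvZ ?IH.
- by rewrite rep_repM Wa ?IH.
- by rewrite rep_repM Wb ?IH.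
Qed.

Hypothesis ab_rel : env_rel a b.
Variables (f1 : {lrmorphism A -> 'M[F]_1}) (f2 : {lrmorphism A -> 'M[F]_2}).
Hypotheses (f1a : f1 a = 0) (f1b : f1 b = 0).
Hypotheses (f2a : f2 a = delta_mx 0 1) (f2b : f2 b = delta_mx 1 0).
Hypothesis irr1 : rep_irreducible (mx_rep f1).
Hypothesis irr2 : rep_irreducible (mx_rep f2).

Lemma irreducible_sqr0 r : rep_irreducible r -> r (a * a) = 0 /\ r (b * b) = 0.
Proof.
move=> [_ r_irr]; have [[aaa aab bba bbb] _] := ab_rel.
(* Right multiplication by [a] or [b] annihilates [a * a] and [b * b], so [W] contains the images of
   both generators and is stable. If it is zero, both generators act by zero. *)
pose W := (lker (r (a * a)) :&: lker (r (b * b)))%VS.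
have Wa v : r a v \in W.
  by rewrite memv_cap !memv_ker -!rep_repM aaa bba linear0 zero_lfunE eqxx.
have Wb v : r b v \in W.
  by rewrite memv_cap !memv_ker -!rep_repM aab bbb linear0 zero_lfunE eqxx.
have [|W0|W1] := r_irr W; first by apply: generated_stable.
  have z v : v \in W -> v = 0 by rewrite W0 memv0 => /eqP.
  by split; apply/lfunP => v;
    rewrite rep_repM ?(z _ (Wa v)) ?(z _ (Wb v)) linear0 zero_lfunE.
have WT v : v \in W by rewrite W1 memvf.
by split; apply/lfunP => v; have := WT v; rewrite memv_cap !memv_ker zero_lfunE;
  case/andP=> /eqP ? /eqP ?.
Qed.

Lemma irreducible_classification r : rep_irreducible r ->
  rep_iso r (mx_rep f1) \/ rep_iso r (mx_rep f2).
Proof.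
move=> r_irr; have [aa bb] := irreducible_sqr0 r_irr.
have [_ [aba bab]] := ab_rel.
have raba v : r a (r b (r a v)) = r a v.
  rewrite -[in RHS]aba linearD add_lfunE -!mulrA !rep_repM.
  by rewrite -[r a (r a v)]rep_repM aa zero_lfunE linear0 addr0.
(* The morphism to be built goes from the matrix module into [r]. *)
have [ra0|ra0] := eqVneq (r a) 0; [left | right]; apply: rep_iso_sym.
  have rb0 : r b = 0.
    apply/lfunP => v; rewrite -[in LHS]bab linearD add_lfunE !rep_repM ra0.
    by rewrite !zero_lfunE !linear0 addr0.
  pose w := vpick (fullv : {vspace rep_space r}).
  have w0 : w != 0 by rewrite vpick0; apply/eqP; case: r_irr.
  have phi_lin : linear (fun c : 'cV[F]_1 => c 0 0 *: w).
    by move=> k c d; rewrite !mxE scalerDl scalerA.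
  pose phi : 'Hom('cV[F]_1, rep_space r) :=
    linfun (HB.pack (fun c : 'cV[F]_1 => c 0 0 *: w)
      (GRing.isLinear.Build F _ _ *:%R _ phi_lin) : {linear _ -> _}).
  have phiE c : phi c = c 0 0 *: w by rewrite lfunE.
  apply: (@rep_schur (mx_rep f1) r phi) => //.
    apply: generated_rep_morph => v; rewrite /= mx_rep_mapE.
      by rewrite f1a ra0 mul0mx linear0 zero_lfunE.
    by rewrite f1b rb0 mul0mx linear0 zero_lfunE.
  apply: contraNneq w0 => phi0; have := phiE (const_mx 1).
  by rewrite phi0 zero_lfunE mxE scale1r => <-.
(* Any nonzero vector in the image of [r a] works, by [aa] and [raba]. *)
have [w1 w1a w10] : exists2 w, r a w = 0 /\ r a (r b w) = w & w != 0.
  have limg0 : limg (r a) != 0%VS.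
    apply: contraNneq ra0 => l0; apply/eqP/lfunP => v.
    by rewrite zero_lfunE; apply/eqP; rewrite -memv0 -l0 memv_img ?memvf.
  have /memv_imgP[v _ wE] := memv_pick (limg (r a)).
  exists (vpick (limg (r a))); last by rewrite vpick0.
  by rewrite wE raba -rep_repM aa zero_lfunE.
(* On [w1], [w2] the generators act as [delta_mx 0 1] and [delta_mx 1 0]; in particular [b] kills
   [w2] because [b * b] acts by zero. *)
have [raw rabw] := w1a; pose w2 := r b w1.
have phi_lin : linear (fun c : 'cV[F]_2 => c 0 0 *: w1 + c 1 0 *: w2).
  by move=> k c d; rewrite !mxE !scalerDl scalerDr !scalerA addrACA.
pose phi : 'Hom('cV[F]_2, rep_space r) :=
  linfun (HB.pack (fun c : 'cV[F]_2 => c 0 0 *: w1 + c 1 0 *: w2)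
    (GRing.isLinear.Build F _ _ *:%R _ phi_lin) : {linear _ -> _}).
have phiE c : phi c = c 0 0 *: w1 + c 1 0 *: w2 by rewrite lfunE.
apply: (@rep_schur (mx_rep f2) r phi) => //.
  have delta_mulE i j (v : 'cV[F]_2) k :
      (delta_mx i j *m v) k 0 = (k == i)%:R * v j 0.
    rewrite mxE (bigD1 j) //= mxE eqxx andbT big1 ?addr0 // => l /negPf nl.
    by rewrite mxE nl andbF mul0r.
  apply: generated_rep_morph => v;
    rewrite /= mx_rep_mapE !phiE linearD !linearZ /=.
    rewrite f2a !delta_mulE /= raw rabw.
    by rewrite !(mul1r, mul0r) scaler0 scale0r addr0 add0r.
  rewrite f2b !delta_mulE /= -[r b w2]rep_repM bb zero_lfunE.
  by rewrite !(mul1r, mul0r) scaler0 scale0r addr0 add0r.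
apply: contraNneq w10 => phi0; have := phiE (delta_mx 0 0).
by rewrite phi0 zero_lfunE !mxE /= scale1r scale0r addr0 => <-.
Qed.
End Schur.

Lemma env_rel0 (F : fieldType) (B : algType F) : env_rel (0 : B) 0.
Proof. by split; split; rewrite !mulr0 ?addr0. Qed.

(** * Wedderburn decomposition and count of irreducible representations *)

Section Conclusion.
Variables (F : fieldType) (A : algType F) (a b : A).
Hypotheses (ab_rel : env_rel a b) (ab_gen : generated_by a b).

Lemma std_basisP (r : {lrmorphism A -> 'M[F]_4}) :
  r a = delta_mx 0 1 + delta_mx 1 2 -> r b = delta_mx 1 0 + delta_mx 0 3 ->
  is_basis predT (std_basis a b).
Proof.
move=> ra rb; split=> //; first exact: std_basis_indep ra rb.
by move=> v _; apply: std_basis_span.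
Qed.

Variable f : {lrmorphism A -> (F^o * 'M[F]_2)%type}.
Hypotheses (fa : f a = (0, delta_mx 0 1)) (fb : f b = (0, delta_mx 1 0)).

Lemma wedderburn (r : {lrmorphism A -> 'M[F]_4}) :
  r a = delta_mx 0 1 + delta_mx 1 2 -> r b = delta_mx 1 0 + delta_mx 0 3 ->
  exists R : tsideal A,
    [/\ is_radical R, has_dim (R : {pred A}) 4,
        (exists S : {pred A},
           [/\ GRing.subalg_closed S, direct_sum (R : {pred A}) S
             & iso_onto_subalg (alg_quot R) S])
      & alg_iso (alg_quot R) (F^o * 'M[F]_2)%type].
Proof.
move=> ra rb; pose g : (F^o * 'M[F]_2)%type -> A := unit_section (std_unit a b).
have gK : cancel g f by exact: std_splitK.
pose gl : {lrmorphism (F^o * 'M[F]_2)%type -> A} := HB.pack g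
  (GRing.isLinear.Build F _ _ *:%R g (unit_section_linear (std_unit a b)))
  (GRing.isMonoidMorphism.Build _ _ g
    (unit_section_monoid_morphism (std_unitM ab_rel))).
exists (rker f); split.
- by apply: (radical_ker gK); apply: (rad_mul0 ab_rel ab_gen fa fb).
- exists (rad_basis a b) => //; split=> [u uR||v /eqP fv].
  + by apply/eqP; apply: (rad_basis_ker ab_rel fa fb).
  + exact: rad_basis_indep ra rb.
  + exact: (rad_basis_span ab_rel ab_gen fa fb).
- exact: (split_subalg (g := gl)).
- exact: (alg_iso_ker (g := gl)).
Qed.

Lemma two_irreducibles (f1 : {lrmorphism A -> 'M[F]_1}) :
  f1 a = 0 -> f1 b = 0 ->
  exists r1 r2 : fdrep A,
    [/\ rep_irreducible r1, rep_irreducible r2, ~ rep_iso r1 r2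
      & forall r : fdrep A,
          rep_irreducible r -> rep_iso r r1 \/ rep_iso r r2].
Proof.
move=> f1a f1b; pose f2 : {lrmorphism A -> 'M[F]_2} := snd \o f.
have irr1 : rep_irreducible (mx_rep f1).
  apply: (mx_rep_irreducible (g := fun X => X 0 0 *: 1)) => X.
  by rewrite linearZ rmorph1 /= scalemx1 -mx11_scalar.
have irr2 : rep_irreducible (mx_rep f2).
  pose g (X : 'M[F]_2) := unit_section (std_unit a b) (0, X).
  apply: (mx_rep_irreducible (g := g)) => X.
  by rewrite /f2 /= std_splitK.
exists (mx_rep f1), (mx_rep f2); split=> //.
  (* The dimensions are 1 and 2. *)
  by move/rep_iso_dim; rewrite /= !dim_matrix.
have [f2a f2b] : f2 a = delta_mx 0 1 /\ f2 b = delta_mx 1 0.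
  by rewrite /f2 /= fa fb.
exact: (irreducible_classification ab_gen ab_rel f1a f1b f2a f2b irr1 irr2).
Qed.
End Conclusion.

Theorem theorem5p2 (F : fieldType) (charF : [pchar F] =i pred0) :
  let U := envelope F in
  let a : U := env_a in
  let b : U := env_b in
  let basis : seq U :=
    [:: 1; a; b; a ^+ 2; a * b; b * a; b ^+ 2; a * b * a; a * b ^+ 2] in
  let table : seq (U * U * U) :=
    [:: (a, a, a ^+ 2); (a, b, a * b); (a, b * a, a * b * a);
        (a, b ^+ 2, a * b ^+ 2);
        (b, a, b * a); (b, b, b ^+ 2); (b, a ^+ 2, a - a * b * a);
        (b, a * b, b - a * b ^+ 2); (b, a * b * a, b * a);
        (b, a * b ^+ 2, b ^+ 2);
        (a * b, a, a * b * a); (a * b, b, a * b ^+ 2);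
        (a * b, a ^+ 2, a ^+ 2); (a * b, a * b, a * b);
        (a * b, a * b * a, a * b * a); (a * b, a * b ^+ 2, a * b ^+ 2);
        (b * a, a, a - a * b * a); (b * a, b, b - a * b ^+ 2);
        (b * a, b * a, b * a); (b * a, b ^+ 2, b ^+ 2);
        (a * b * a, a, a ^+ 2); (a * b * a, b, a * b);
        (a * b * a, b * a, a * b * a); (a * b * a, b ^+ 2, a * b ^+ 2)] in
  [/\ is_basis predT basis,
      (forall x y z : U, (x, y, z) \in table -> x * y = z) /\
      (forall x y : U, x \in behead basis -> y \in behead basis ->
         (x, y) \notin [seq t.1 | t <- table] -> x * y = 0),
      (exists R : tsideal U,
         [/\ is_radical R, has_dim (R : {pred U}) 4,
             (exists S : {pred U},
                [/\ GRing.subalg_closed S, direct_sum (R : {pred U}) S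
                  & iso_onto_subalg (alg_quot R) S])
           & alg_iso (alg_quot R) (F^o * 'M[F]_2)%type])
    & exists r1 r2 : fdrep U,
        [/\ rep_irreducible r1, rep_irreducible r2, ~ rep_iso r1 r2
          & forall r : fdrep U,
              rep_irreducible r -> rep_iso r r1 \/ rep_iso r r2]].
Proof.
move=> U a b basis table.
have ab_rel : env_rel a b := env_relP charF.
have ab_gen : generated_by a b := @env_ind F.
(* The universal property supplies three morphisms: [f] onto the semisimple quotient, [r] for linear
   independence, and [f1], the augmentation, for the one-dimensional module. *)
pose f : {lrmorphism U -> (F^o * 'M[F]_2)%type} := env_lift (env_rel_pair F).
have [fa fb] : f a = (0, delta_mx 0 1) /\ f b = (0, delta_mx 1 0).
  by split; [exact: env_lift_a | exact: env_lift_b].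
pose r : {lrmorphism U -> 'M[F]_4} := env_lift (env_rel_mx4 F).
have ra : r a = delta_mx 0 1 + delta_mx 1 2 by exact: env_lift_a.
have rb : r b = delta_mx 1 0 + delta_mx 0 3 by exact: env_lift_b.
pose f1 : {lrmorphism U -> 'M[F]_1} := env_lift (env_rel0 _).
have [f1a f1b] : f1 a = 0 /\ f1 b = 0.
  by split; [exact: env_lift_a | exact: env_lift_b].
split.
- exact: std_basisP ra rb.
- by split; [exact: (std_tableP ab_rel) | exact: (std_table0 ab_rel)].
- exact: wedderburn fa fb r ra rb.
- exact: two_irreducibles fa fb f1 f1a f1b.
Qed.
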